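(* Let $(X,d)$ be a compact metric space, $\boldsymbol f=\{f_i\}_{i=1}^\infty$ a sequence of continuous self-maps of $X$, and $Z\subseteq X$. Call $Z$ $\boldsymbol f$-forward invariant if $f_k(Z)\subseteq Z$ for all $k\in\mathbb N$, $\boldsymbol f$-backward invariant if $Z\subseteq f_k(Z)$ for all $k\in\mathbb N$, and $\boldsymbol f$-invariant if $f_k(Z)=Z$ for all $k\in\mathbb N$. Then for any $\varphi\in C(X,\mathbb R)$, $1\le i<j<\infty$ and $\theta\in[0,1]$, the following hold: (1) If $Z$ is forward invariant, then $\underline P(\boldsymbol f_i,Z,\varphi,\theta)\le\underline P(\boldsymbol f_j,Z,\varphi,\theta)$ and $\overline P(\boldsymbol f_i,Z,\varphi,\theta)\le\overline P(\boldsymbol f_j,Z,\varphi,\theta)$. (2) If $Z$ is backward invariant, then $\underline P(\boldsymbol f_i,Z,\varphi,\theta)\ge\underline P(\boldsymbol f_j,Z,\varphi,\theta)$ and $\overline P(\boldsymbol f_i,Z,\varphi,\theta)\ge\overline P(\boldsymbol f_j,Z,\varphi,\theta)$. (3) If $Z$ is invariant, then $\underline P(\boldsymbol f_i,Z,\varphi,\theta)=\underline P(\boldsymbol f_j,Z,\varphi,\theta)$ and $\overline P(\boldsymbol f_i,Z,\varphi,\theta)=\overline P(\boldsymbol f_j,Z,\varphi,\theta)$. Here $\boldsymbol f_n=\{f_l\}_{l=n}^\infty$ and $\underline P,\overline P$ are the lower and upper $\theta$-intermediate topological pressures.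
   Context: Pressures take values in $[-\infty,+\infty]$. $C(X,\mathbb R)$ is the space of continuous real functions on $X$. The pressures are defined below for a general sequence $\boldsymbol f=\{f_i\}_{i\ge1}$ of continuous self-maps of $X$; for $\boldsymbol f_n=\{f_l\}_{l\ge n}$ one applies the definition to this sequence re-indexed so that its first map is $f_n$ (thus $f_1^j$ is replaced by $f_n^j=f_{n+j-1}\circ\cdots\circ f_n$). Put $f_1^0=\mathrm{id}_X$, $f_1^n=f_n\circ\cdots\circ f_1$, and $S_n\varphi(x)=\sum_{j=0}^{n-1}\varphi(f_1^j x)$. For a finite open cover $\mathcal U$ of $X$, $\mathcal S_m(\mathcal U)$ is the set of strings $\mathbf U=(U_0,\dots,U_{m-1})$ with all $U_j\in\mathcal U$; $m(\mathbf U)=m$ is the length of $\mathbf U$; and $X(\mathbf U)=\{x\in X: f_1^j(x)\in U_j,\ 0\le j\le m-1\}$. For $Z\subseteq X$, $\alpha\in\mathbb R$, $N\in\mathbb N$, $\theta\in[0,1]$ let $$M(Z,\alpha,\varphi,\mathcal U,N,\theta)=\inf_{\mathcal G}\sum_{\mathbf U\in\mathcal G}\exp\Bigl(-\alpha m(\mathbf U)+\sup_{x\in X(\mathbf U)}S_{m(\mathbf U)}\varphi(x)\Bigr),$$ the infimum over all finite or countable collections $\mathcal G$ of strings of lengths $m$ with $N\le m<N/\theta+1$ (for $\theta=0$: $m\ge N$) such that $Z\subseteq\bigcup_{\mathbf U\in\mathcal G}X(\mathbf U)$; the supremum over an empty $X(\mathbf U)$ is $-\infty$ (so the term is $0$).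 Let $\underline m$ and $\overline m$ be the $\liminf$ and $\limsup$ of $M(Z,\alpha,\varphi,\mathcal U,N,\theta)$ as $N\to\infty$, and $$\underline P(\boldsymbol f,Z,\varphi,\mathcal U,\theta)=\inf\{\alpha:\underline m=0\}=\sup\{\alpha:\underline m=\infty\},\quad \overline P(\boldsymbol f,Z,\varphi,\mathcal U,\theta)=\inf\{\alpha:\overline m=0\}=\sup\{\alpha:\overline m=\infty\}.$$ With $|\mathcal U|=\max_{U\in\mathcal U}\operatorname{diam}U$, the lower and upper $\theta$-intermediate topological pressures are $\underline P(\boldsymbol f,Z,\varphi,\theta)=\lim_{|\mathcal U|\to0}\underline P(\boldsymbol f,Z,\varphi,\mathcal U,\theta)$ and $\overline P(\boldsymbol f,Z,\varphi,\theta)=\lim_{|\mathcal U|\to0}\overline P(\boldsymbol f,Z,\varphi,\mathcal U,\theta)$ (these limits exist). *)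

(* Defs.v *)
(* Mathematical Components and MathComp-Analysis. *)
From HB Require Import structures.
From mathcomp Require Import all_boot all_order all_algebra.
From mathcomp Require Import all_classical all_reals all_analysis.
Set Implicit Arguments.
Unset Strict Implicit.
Unset Printing Implicit Defensive.
Import Order.TTheory GRing.Theory Num.Theory.
Import numFieldNormedType.Exports.
Local Open Scope classical_set_scope.
Local Open Scope ring_scope.

Section Dynamics.
Context {X : Type}.

(* A sequence of self-maps f_1, f_2, ... is a function f : nat -> X -> X;
   f 0 is never used. *)
Implicit Types (f : nat -> X -> X) (Z : set X).

(* f_1^n = f_n \o ... \o f_1 *)
Fixpoint iter_seq f (n : nat) : X -> X :=
  if n is m.+1 then f m.+1 \o iter_seq f m else id.

(* The sequence (f_l)_{l >= n}, re-indexed so that its first map is f_n. *)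
Definition tail_seq f (n : nat) : nat -> X -> X := fun l => f (n + l - 1)%N.

Definition forward_invariant f Z := forall k, (1 <= k)%N -> f k @` Z `<=` Z.

Definition backward_invariant f Z := forall k, (1 <= k)%N -> Z `<=` f k @` Z.

Definition seq_invariant f Z := forall k, (1 <= k)%N -> f k @` Z = Z.

End Dynamics.

Section Pressure.
Context {R : realType} {X : metricType R}.
Implicit Types (f : nat -> X -> X) (phi : X -> R) (Z : set X).
Implicit Types (UU : set (set X)) (s : seq (set X)) (theta : R).

Definition birkhoff_sum f phi (n : nat) (x : X) : R :=
  \sum_(0 <= j < n) phi (iter_seq f j x).

Definition finite_open_cover UU :=
  [/\ finite_set UU, UU `<=` open & \bigcup_(U in UU) U = [set: X]].

Definition diam (A : set X) : \bar R :=
  maxe 0%E (ereal_sup [set (mdist x y)%:E | x in A & y in A]).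

(* |UU|; the supremum is a maximum when UU is finite and nonempty. *)
Definition mesh UU : \bar R := ereal_sup [set diam U | U in UU].

(* A string (U_0, ..., U_{m-1}) is a sequence of size m. *)
Definition is_string UU s := [set` s] `<=` UU.

(* X(U_0, ..., U_{m-1}) *)
Definition cylinder f s : set X :=
  [set x | forall j, (j < size s)%N -> nth set0 s j (iter_seq f j x)].

(* N <= m < N / theta + 1; no upper bound when theta = 0 (the guard is needed
   because N / 0 = 0 in the library). *)
Definition admissible_length theta (N m : nat) :=
  (N <= m)%N /\ (theta != 0 -> m%:R < N%:R / theta + 1).

Definition admissible_collection f Z UU (N : nat) theta
    (G : set (seq (set X))) :=
  [/\ countable G,
      forall s, G s -> is_string UU s,
      forall s, G s -> admissible_length theta N (size s) &
      Z `<=` \bigcup_(s in G) cylinder f s].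

(* ereal_sup set0 = -oo and expeR -oo = 0, so the weight of a string with an
   empty cylinder is 0. *)
Definition string_weight f (alpha : R) phi s : \bar R :=
  expeR ((- (alpha * (size s)%:R))%:E
         + ereal_sup [set (birkhoff_sum f phi (size s) x)%:E
                     | x in cylinder f s])%E.

Definition outer_sum f Z (alpha : R) phi UU (N : nat) theta : \bar R :=
  ereal_inf [set \esum_(s in G) string_weight f alpha phi s
            | G in admissible_collection f Z UU N theta].

Definition lower_outer_sum f Z (alpha : R) phi UU theta : \bar R :=
  limn_einf (fun N => outer_sum f Z alpha phi UU N theta).

Definition upper_outer_sum f Z (alpha : R) phi UU theta : \bar R :=
  limn_esup (fun N => outer_sum f Z alpha phi UU N theta).

Definition lower_pressure_cover f Z phi theta UU : \bar R :=
  ereal_inf [set alpha%:E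
            | alpha in [set a | lower_outer_sum f Z a phi UU theta = 0%E]].

Definition upper_pressure_cover f Z phi theta UU : \bar R :=
  ereal_inf [set alpha%:E
            | alpha in [set a | upper_outer_sum f Z a phi UU theta = 0%E]].

(* The filter "|UU| -> 0" on the finite open covers of X. *)
Definition mesh_to0 : set_system (set (set X)) :=
  filter_from [set delta : R | 0 < delta]
    (fun delta => [set UU | finite_open_cover UU /\ (mesh UU < delta%:E)%E]).

Definition lower_pressure f Z phi theta : \bar R :=
  lim (lower_pressure_cover f Z phi theta UU @[UU --> mesh_to0]).

Definition upper_pressure f Z phi theta : \bar R :=
  lim (upper_pressure_cover f Z phi theta UU @[UU --> mesh_to0]).

End Pressure.

(* Main.v *)
(* A string for f_{i+1} becomes one for f_i, of the same length, by dropping its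
   last set and prepending any U in the cover; a string for f_i becomes one for
   f_{i+1} by dropping its first set and appending any U. If Z is forward
   (resp. backward) invariant the new strings still cover Z. On the new cylinders
   the Birkhoff sums of length m grow by at most m * gamma + const, gamma being the
   oscillation of phi on the members of the cover, so for a fixed cover the
   pressures compare up to gamma, which vanishes with the mesh. The limit over
   covers exists: by the Lebesgue number lemma, a cover of small mesh refines a
   given one, and the same comparison applies with lengths unchanged. *)
Require Import Defs.
From HB Require Import structures.
From mathcomp Require Import all_boot all_order all_algebra.
From mathcomp Require Import all_classical all_reals all_analysis.
From mathcomp Require Import finmap lra.
Set Implicit Arguments.
Unset Strict Implicit.
Unset Printing Implicit Defensive.
Import Order.TTheory GRing.Theory Num.Theory.
Import numFieldNormedType.Exports.
Local Open Scope classical_set_scope.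
Local Open Scope ring_scope.

(** * Sums of extended reals over sets of indices *)

Lemma esum_subset (R : realType) (T : choiceType) (A B : set T) (a : T -> \bar R) :
  A `<=` B -> (\esum_(i in A) a i <= \esum_(i in B) a i)%E.
Proof.
move=> AB; apply: ge_ereal_sup => _ [F [finF FA] <-]; apply: esum_ge.
by exists F => //; split => //; exact: subset_trans AB.
Qed.

(** Picking one preimage in [P] for each point of the image is an injection, so the left side
    becomes a sum over part of [P]. *)
Lemma esum_image_le (R : realType) (T T' : choiceType) (P : set T)
    (e : T -> T') (a : T' -> \bar R) :
  (\esum_(j in e @` P) a j <= \esum_(i in P) a (e i))%E.
Proof.
have [->|/set0P[p0 Pp0]] := eqVneq P set0; first by rewrite image_set0 !esum_set0.
have /choice[s sP] : forall j, exists i, (e @` P) j -> P i /\ e i = j.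
  move=> j; have [[i Pi <-]|nPj] := pselect ((e @` P) j); last by exists p0.
  by exists i.
rewrite (eq_esum (b := fun j => a (e (s j)))); last by move=> j /sP[_ ->].
rewrite -(esum_image (e @` P) s (fun i => a (e i))); last first.
  by move=> j k /set_mem/sP[_ {2}<-] /set_mem/sP[_ {2}<-] ->.
by apply: esum_subset => _ [j /sP[Psj _] <-].
Qed.

(** * Vanishing lower and upper limits, and limits along a filter *)

Section NullLimits.
Context {R : realType}.
Implicit Types u v : (\bar R)^nat.

(** The property of liminf and limsup on which the argument rests, so that both pressures are
    treated at once. Index 0 is left out because for [N = 0] the empty string is admissible, and it
    has no set to drop. *)
Definition null_preserving (L : (\bar R)^nat -> \bar R) :=
  forall (c : R) u v, 0 < c -> (forall n, 0 <= v n)%E ->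
    (forall n, (0 < n)%N -> (v n <= c%:E * u n)%E) -> L u = 0%E -> L v = 0%E.

Lemma null_preserving_limn_einf : null_preserving limn_einf.
Proof.
move=> c u v c0 v0 vu; rewrite !limn_einf_lim => u_lim.
have einfs_u0 : einfs u @ \oo --> 0%E by rewrite -u_lim; exact: is_cvg_einfs.
apply/cvg_lim => //; have := cvgeZl (erefl : c%:E \is a fin_num) einfs_u0.
rewrite mule0; apply: (squeeze_cvge _ (cvg_cst 0%E)).
(* From index 1 on, [einfs v] lies between 0 and [c] times [einfs u]. *)
exists 1%N => // n /= n0; apply/andP; split.
  by apply: le_ereal_inf_tmp => _ [m _ <-].
rewrite -lee_pdivrMl//; apply: le_ereal_inf_tmp => _ [m /= nm <-].
rewrite lee_pdivrMl// (le_trans _ (vu m (leq_trans n0 nm)))//.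
by apply: ereal_inf_lbound; exists m.
Qed.

Lemma null_preserving_limn_esup : null_preserving limn_esup.
Proof.
move=> c u v c0 v0 vu; rewrite !limn_esup_lim => u_lim.
have esups_u0 : esups u @ \oo --> 0%E by rewrite -u_lim; exact: is_cvg_esups.
apply/cvg_lim => //; have := cvgeZl (erefl : c%:E \is a fin_num) esups_u0.
rewrite mule0; apply: (squeeze_cvge _ (cvg_cst 0%E)).
exists 1%N => // n /= n0; apply/andP; split.
  by apply: le_trans (v0 n) _; apply: ereal_sup_ubound; exists n => /=.
apply: ge_ereal_sup => _ [m /= nm <-].
apply: le_trans (vu m (leq_trans n0 nm)) _.
rewrite lee_pmul2l//; apply: ereal_sup_ubound; exists m => //.
Qed.

End NullLimits.

(** The hypothesis bounds the upper limit along [F] by the lower limit [l] plus [e], for every [e],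
    so the two agree. *)
Lemma is_cvge_almost_le (R : realType) (T : Type) (F : set_system T)
    (FF : ProperFilter F) (a : T -> \bar R) :
  (forall e : R, 0 < e ->
    \forall x \near F, \forall y \near F, (a x <= a y + e%:E)%E) ->
  cvg (a x @[x --> F]).
Proof.
move=> a_le; pose l := ereal_sup [set ereal_inf (a @` V) | V in F].
have a_gt (r : \bar R) : (r < l)%E -> \forall x \near F, (r < a x)%E.
  case/ereal_sup_gt => _ [V FV <-] rV; apply: filterS FV => x Vx.
  by apply: lt_le_trans rV _; apply: ereal_inf_lbound; exists x.
have a_le_l (e : R) : 0 < e -> \forall x \near F, (a x <= l + e%:E)%E.
  move=> e0; apply: filterS (a_le e e0) => x axy; rewrite -leeBlDr//.
  (* For fixed [x] the set of good [y] belongs to [F], so its infimum is among those whose supremum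
     is [l]. *)
  apply: (@le_trans _ _ (ereal_inf (a @` [set y | (a x <= a y + e%:E)%E]))).
    by apply: le_ereal_inf_tmp => _ [y xy <-]; rewrite leeBlDr.
  by apply: ereal_sup_ubound; eexists; first exact: axy.
apply/cvg_ex; exists l; case: l => [l| |] in a_gt a_le_l *.
- apply/fine_cvgP; split.
    have := a_gt (l - 1)%:E; rewrite lte_fin ltrBlDr ltrDl => /(_ ltr01).
    apply: filterS2 (a_le_l 1 ltr01) => x.
    by case: (a x) => //=; rewrite leye_eq.
  apply/cvgrPdist_le => e e0.
  have := a_gt (l - e)%:E; rewrite lte_fin ltrBlDr ltrDl => /(_ e0).
  apply: filterS2 (a_le_l e e0) => x /=.
  case: (a x) => [r| |] //=; rewrite -?EFinD ?lee_fin ?lte_fin ?leye_eq//.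
  by move=> h1 h2; rewrite ler_distlC h1 ltW.
- by apply/cvgeyPgt => r; apply: a_gt; rewrite ltry.
- apply/cvgeNyPle => r; apply: filterS (a_le_l 1 ltr01) => x.
  by rewrite addNye leeNy_eq => /eqP ->; rewrite leNye.
Qed.

Lemma lime_almost_le (R : realType) (T : Type) (F : set_system T)
    (FF : ProperFilter F) (a b : T -> \bar R) :
  cvg (a x @[x --> F]) -> cvg (b x @[x --> F]) ->
  (forall e : R, 0 < e -> \forall x \near F, (a x <= b x + e%:E)%E) ->
  (lim (a x @[x --> F]) <= lim (b x @[x --> F]))%E.
Proof.
move=> cva cvb ab; apply/lee_addgt0Pr => e e0.
have cvbe : b x + e%:E @[x --> F] --> (lim (b x @[x --> F]) + e%:E)%E.
  by apply: cvgeD => //; [rewrite fin_num_adde_defl|exact: cvg_cst].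
rewrite -(cvg_lim _ cvbe)//.
(* lee_lim needs a topology on the domain of the functions, so the filter is
   pushed forward to the pairs of their values. *)
apply: (@lee_lim (\bar R * \bar R)%type ((fun x => (a x, b x)) x @[x --> F]) _ R
  fst (fun p => p.2 + e%:E)%E) => //; last exact: ab.
by apply/cvg_ex; eexists; exact: cvbe.
Qed.

(** * Lebesgue numbers and covers of small mesh *)

Section CompactMetric.
Context {R : realType} {X : metricType R}.
Hypothesis X_compact : compact [set: X].

Lemma mdist_le_diam (A : set X) x y : A x -> A y -> ((mdist x y)%:E <= diam A)%E.
Proof.
move=> Ax Ay; rewrite /diam le_max; apply/orP; right.
by apply: ereal_sup_ubound; exists x => //; exists y.
Qed.

(** Compactness, in the form of near coverings, turns radii that work near each point into one
    radius [d] for all points. A set of diameter below [d] lies in the ball of radius [d] about any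
    of its points. *)
Lemma lebesgue_number (UU : set (set X)) :
  UU `<=` open -> \bigcup_(U in UU) U = [set: X] ->
  exists2 delta : R, 0 < delta & forall A : set X, A !=set0 ->
    (diam A < delta%:E)%E -> exists2 U, UU U & A `<=` U.
Proof.
move=> UUo UUcov.
have cov : near_covering [set: X] by exact/compact_near_coveringP.
pose P (d : R) (x : X) := exists2 U, UU U & ball x d `<=` U.
have /cov : forall x, [set: X] x -> \forall x' \near x & d \near 0^'+, P d x'.
  move=> x _; have [U UUU Ux] : (\bigcup_(U in UU) U) x by rewrite UUcov.
  have /nbhs_ballP[e /= e0 xeU] : nbhs x U.
    by apply: open_nbhs_nbhs; split => //; exact: UUo.
  (* Half of [e] pays for moving the centre from [x] to [x'], half for the radius [d]. *)
  near=> x' d; have de : d <= e / 2 by near: d; apply: nbhs_right_le; exact: divr_gt0.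
  exists U => // y x'y; apply: xeU.
  apply: (@ball_split _ _ x'); last exact: le_ball de _ x'y.
  by near: x'; apply: nbhsx_ballx; exact: divr_gt0.
move=> Pd; have [d [/(_ _ I) {}Pd d0]] := filter_ex (filterI Pd (nbhs_right_gt 0)).
exists d => // A [x Ax] Ad; have [U UUU xU] := Pd x.
exists U => // y Ay; apply: xU; rewrite ballEmdist /= -lte_fin.
exact: le_lt_trans (mdist_le_diam Ax Ay) Ad.
Unshelve. all: by end_near. Qed.

(** Take a Lebesgue number of the family of all open sets on which [phi] oscillates by at most [e];
    it covers by continuity. *)
Lemma small_oscillation (phi : X -> R) (e : R) : continuous phi -> 0 < e ->
  exists2 delta : R, 0 < delta & forall A : set X, (diam A < delta%:E)%E ->
    forall x y, A x -> A y -> `|phi x - phi y| <= e.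
Proof.
move=> phi_cont e0.
pose UU := [set U : set X | open U /\ forall x y, U x -> U y -> `|phi x - phi y| <= e].
have [U []//||d d0 dUU] := @lebesgue_number UU.
  rewrite -subTset => x _; exists (phi @^-1` ball (phi x) (e / 2))°; last first.
    apply: phi_cont; apply: nbhsx_ballx; exact: divr_gt0.
  split; first exact: open_interior.
  move=> y z /interior_subset/= xy /interior_subset/= xz.
  by apply: ltW; apply: (ball_splitr xy xz).
exists d => // A /dUU Ad x y Ax Ay.
have [|U [_ UP] AU] := Ad; first by exists x.
by apply: UP; exact: AU.
Qed.

(** This makes the filter [mesh_to0] proper. Balls of radius [delta / 4] have diameter at most
    [delta / 2], strictly below [delta]. *)
Lemma finite_open_cover_small (delta : R) : 0 < delta ->
  exists UU : set (set X), finite_open_cover UU /\ (mesh UU < delta%:E)%E.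
Proof.
move=> d0; pose e := delta / 4; have e0 : 0 < e by exact: divr_gt0.
have cov : near_covering [set: X] by exact/compact_near_coveringP.
(* Near [F] means: for all large enough finite sets of centres. The near covering property along [F]
   then yields finitely many balls that cover [X]. *)
pose F := filter_from (@finite_set X)
  (fun D => [set E : set X | finite_set E /\ D `<=` E]).
have FF : Filter F.
  apply: filter_from_filter; first by exists set0; exact: finite_set0.
  move=> D E finD finE; exists (D `|` E); first by rewrite finite_setU.
  by move=> G [finG]; rewrite subUset => -[].
have /cov : forall x, [set: X] x -> \forall x' \near x & D \near F,
    exists2 c, D c & (ball c e)° x'.
  move=> x _; near=> x' D; exists x.
    near: D; exists [set x]; first exact: finite_set1.
    by move=> E [_]; apply.
  by near: x'; apply: nbhs_interior; exact: nbhsx_ballx.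
move=> [D finD DP]; have {DP} Dcov := DP D (conj finD (fun _ h => h)).
exists [set (ball c e)° | c in D]; split; first split.
- exact: finite_image.
- by move=> _ [c _ <-]; exact: open_interior.
- rewrite -subTset => x /Dcov[c Dc cx]; exists (ball c e)° => //; exists c => //.
apply: (@le_lt_trans _ _ (e + e)%:E); last first.
  by rewrite lte_fin /e; lra.
apply: ge_ereal_sup => _ [_ [c Dc <-] <-].
rewrite /diam ge_max lee_fin addr_ge0 ?(ltW e0)//=.
apply: ge_ereal_sup => _ [x /interior_subset cx [y /interior_subset cy <-]].
have := ball_triangle (ball_sym cx) cy.
by rewrite ballEmdist /= lee_fin => /ltW.
Unshelve. all: by end_near. Qed.

Lemma mesh_to0_filter : ProperFilter (@mesh_to0 R X).
Proof.
apply: filter_from_proper; last first.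
  by move=> d d0; have [UU UUd] := finite_open_cover_small d0; exists UU.
apply: filter_from_filter; first by exists 1; rewrite /= ltr01.
move=> d e /= d0 e0; exists (Num.min d e); first by rewrite /= lt_min d0.
by move=> UU [UUc]; rewrite EFin_min lt_min => /andP[].
Qed.

End CompactMetric.

(** * Comparing outer sums by replacing strings *)

Section Comparison.
Context {R : realType} {X : metricType R}.
Implicit Types (f g : nat -> X -> X) (phi : X -> R) (Z W : set X).
Implicit Types (UU VV : set (set X)) (s t : seq (set X)) (theta alpha gamma c : R).

Lemma outer_sum_ge0 f Z alpha phi UU N theta :
  (0 <= outer_sum f Z alpha phi UU N theta)%E.
Proof.
by apply: le_ereal_inf_tmp => _ [G _ <-]; apply: esum_ge0 => s _; exact: expeR_ge0.
Qed.

(** Raising [alpha] by [gamma] cancels the linear growth of the Birkhoff sums and leaves the factor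
    [expR c]. If [s] had an empty cylinder, its weight would be 0 while that of [t] could be
    positive. *)
Lemma string_weight_le f g alpha gamma c phi s t :
  cylinder f s !=set0 -> size t = size s ->
  (forall x y, cylinder f s x -> cylinder g t y ->
     birkhoff_sum g phi (size s) y
       <= birkhoff_sum f phi (size s) x + gamma * (size s)%:R + c) ->
  (string_weight g (alpha + gamma) phi t
     <= (expR c)%:E * string_weight f alpha phi s)%E.
Proof.
move=> [x sx] ts gf; rewrite /string_weight ts.
set m := size s in ts gf *.
pose b := birkhoff_sum f phi m x.
apply: (@le_trans _ _ (expeR ((- ((alpha + gamma) * m%:R))%:E
    + (b + gamma * m%:R + c)%:E))%E).
  rewrite lee_expeR leeD2l//; apply: ge_ereal_sup => _ [y ty <-].
  by rewrite lee_fin; exact: gf.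
apply: (@le_trans _ _ ((expR c)%:E * expeR ((- (alpha * m%:R))%:E + b%:E))%E).
  by rewrite -!EFinD /= -EFinM -expRD lee_fin ler_expR; lra.
rewrite lee_wpmul2l ?lee_fin ?expR_ge0// lee_expeR leeD2l//.
by apply: ereal_sup_ubound; exists x.
Qed.

(** The successor keeps the factor positive even for empty [I], as the constant [C] of the next
    lemma must be. *)
Lemma esum_cst_le (T : choiceType) (I : set T) (S : \bar R) :
  finite_set I -> (0 <= S)%E ->
  (\esum_(k in I) S <= (#|` fset_set I|.+1%:R)%:E * S)%E.
Proof.
move=> finI S0; rewrite esum_fset// fsbig_finite// big_const_seq count_predT.
apply: (@le_trans _ _ (#|` fset_set I|%:R%:E * S)%E); last first.
  by rewrite lee_wpmul2r// lee_fin ler_nat.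
elim: #|` _| => [|n IHn] /=; first by rewrite mul0e.
by rewrite mule_natl muleS -mule_natl leeD2l.
Qed.

(* [h k s], for [k] in the finite set [I], are the strings replacing [s];
   strings with empty cylinder are discarded first. *)
Lemma outer_sum_transfer (T : choiceType) (I : set T)
    (h : T -> seq (set X) -> seq (set X)) f g Z W UU VV phi gamma c theta :
  finite_set I ->
  (forall k s x, I k -> (0 < size s)%N -> is_string UU s -> cylinder f s x ->
     [/\ is_string VV (h k s), size (h k s) = size s &
         forall y, cylinder g (h k s) y -> birkhoff_sum g phi (size s) y
           <= birkhoff_sum f phi (size s) x + gamma * (size s)%:R + c]) ->
  (forall w, W w -> exists2 z, Z z &
     forall s, (0 < size s)%N -> is_string UU s -> cylinder f s z ->
       exists2 k, I k & cylinder g (h k s) w) ->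
  exists2 C : R, 0 < C & forall N alpha, (0 < N)%N ->
    (outer_sum g W (alpha + gamma) phi VV N theta
       <= C%:E * outer_sum f Z alpha phi UU N theta)%E.
Proof.
move=> finI hP WZ; pose n := #|` fset_set I|.
exists (n.+1%:R * expR c); first by rewrite mulr_gt0 ?expR_gt0.
(* With the constant on the left, it suffices to treat one collection [G] for [f] at a time. *)
move=> N alpha N0; rewrite -lee_pdivrMl ?mulr_gt0 ?expR_gt0//.
apply: le_ereal_inf_tmp => _ [G [cG GUU GN GZ] <-].
rewrite lee_pdivrMl ?mulr_gt0 ?expR_gt0//.
pose G1 := G `&` [set s | cylinder f s !=set0].
have G1P s : G1 s -> [/\ is_string UU s, (0 < size s)%N & cylinder f s !=set0].
  by move=> [Gs ?]; split => //; [exact: GUU|have [/(leq_trans N0)] := GN _ Gs].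
pose P := I `*`` (fun _ => G1); pose G' := [set h p.1 p.2 | p in P].
apply: (@le_trans _ _ (\esum_(t in G') string_weight g (alpha + gamma) phi t)%E).
  apply: ereal_inf_lbound; exists G' => //; split.
  - apply: sub_countable (card_image_le _ _) _.
    apply: countableX; first exact: finite_set_countable.
    by apply: sub_countable cG; apply: subset_card_le; exact: subIsetl.
  - move=> _ [[k s] [/= Ik /G1P[sUU s0 [x sx]]] <-].
    by have [] := hP k s x Ik s0 sUU sx.
  - move=> _ [[k s] [/= Ik G1s] <-]; have [sUU s0 [x sx]] := G1P _ G1s.
    have [_ -> _] := hP k s x Ik s0 sUU sx; case: G1s => + _; exact: GN.
  - move=> w /WZ[z Zz zP]; have [s Gs sz] := GZ _ Zz.
    (* The point [z] itself shows that [s] was not discarded. *)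
    have G1s : G1 s by split => //; exists z.
    have [sUU s0 _] := G1P _ G1s.
    have [k Ik hw] := zP s s0 sUU sz.
    by exists (h k s) => //; exists (k, s).
apply: le_trans (esum_image_le _ _ _) _.
apply: (@le_trans _ _ (\esum_(p in P) ((expR c)%:E * string_weight f alpha phi p.2))%E).
  apply: le_esum => -[k s] [/= Ik /G1P[sUU s0 [x sx]]].
  apply: string_weight_le; first by exists x.
    by have [] := hP k s x Ik s0 sUU sx.
  by move=> x' y sx'; have [_ _] := hP k s x' Ik s0 sUU sx'; apply.
have w0 s : (0 <= string_weight f alpha phi s)%E by exact: expeR_ge0.
have cw0 s : (0 <= (expR c)%:E * string_weight f alpha phi s)%E.
  by rewrite mule_ge0// lee_fin expR_ge0.
(* The bound does not depend on [k], so the sum over pairs is a sum over [I] of a constant. *)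
rewrite -(esum_esum (a := fun _ s => ((expR c)%:E * string_weight f alpha phi s)%E))//.
apply: le_trans (esum_cst_le finI (esum_ge0 (fun s _ => cw0 s))) _.
rewrite EFinM -muleA lee_wpmul2l ?lee_fin//.
apply: le_trans (esum_subset _ (@subIsetl _ _ _)) _.
apply: ge_ereal_sup => _ [F [finF FG] <-].
rewrite -ge0_mule_fsumr// lee_wpmul2l ?lee_fin ?expR_ge0//.
by apply: esum_ge; exists F.
Qed.

(** At [limn_einf] and [limn_esup], this and [pressure] unfold to the lower and upper notions of the
    statement. *)
Definition pressure_cover (L : (\bar R)^nat -> \bar R) f Z phi theta UU : \bar R :=
  ereal_inf [set alpha%:E | alpha in
    [set a | L (fun N => outer_sum f Z a phi UU N theta) = 0%E]].

Definition pressure L f Z phi theta : \bar R :=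
  lim (pressure_cover L f Z phi theta UU @[UU --> mesh_to0]).

(** If the limit for [f] vanishes at [a], the limit for [g] vanishes at [a + gamma]. *)
Lemma pressure_cover_le L f g Z W UU VV phi gamma C theta :
  null_preserving L -> 0 < C ->
  (forall N alpha, (0 < N)%N ->
    (outer_sum g W (alpha + gamma) phi VV N theta
       <= C%:E * outer_sum f Z alpha phi UU N theta)%E) ->
  (pressure_cover L g W phi theta VV
     <= pressure_cover L f Z phi theta UU + gamma%:E)%E.
Proof.
move=> L0 C0 gf; rewrite -leeBlDr//; apply: le_ereal_inf_tmp => _ [a La <-].
rewrite leeBlDr//; apply: ereal_inf_lbound; exists (a + gamma) => //=.
apply: L0 La => [|N|N N0]; [exact: C0|exact: outer_sum_ge0|exact: gf].
Qed.

Definition oscillation_le phi UU gamma :=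
  forall U, UU U -> forall x y, U x -> U y -> `|phi x - phi y| <= gamma.

(** At each time both orbits visit the same set of the string, so each term changes by at most
    [gamma]. *)
Lemma birkhoff_sum_osc f phi UU gamma s x y :
  oscillation_le phi UU gamma -> is_string UU s ->
  cylinder f s x -> cylinder f s y ->
  birkhoff_sum f phi (size s) y
    <= birkhoff_sum f phi (size s) x + gamma * (size s)%:R.
Proof.
move=> osc sUU sx sy; rewrite /birkhoff_sum !big_mkord.
rewrite mulr_natr -[X in _ *+ X]card_ord -sumr_const -big_split /=.
apply: ler_sum => j _; rewrite -lerBlDl; apply: le_trans (ler_norm _) _.
apply: (osc (nth set0 s j)); [|exact: sy|exact: sx].
by apply: sUU; rewrite /= mem_nth.
Qed.

Lemma cylinder_rcons f s U x :
  cylinder f (rcons s U) x <-> cylinder f s x /\ U (iter_seq f (size s) x).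
Proof.
rewrite /cylinder /= size_rcons; split => [sx|[sx Ux] j].
  split => [j js|]; last by have := sx _ (leqnn _); rewrite nth_rcons ltnn eqxx.
  by have := sx j (ltnW js); rewrite nth_rcons js.
rewrite ltnS leq_eqVlt nth_rcons => /predU1P[->|js]; first by rewrite ltnn eqxx.
by rewrite js; exact: sx.
Qed.

Lemma birkhoff_sumSr f phi n x :
  birkhoff_sum f phi n.+1 x = birkhoff_sum f phi n x + phi (iter_seq f n x).
Proof. by rewrite /birkhoff_sum big_nat_recr. Qed.

Lemma is_string_cons UU U s : is_string UU (U :: s) <-> UU U /\ is_string UU s.
Proof.
split=> [sUU|[UUU sUU] V /=]; last by rewrite inE => /predU1P[->//|]; exact: sUU.
split; first by apply: sUU; rewrite /= mem_head.
by move=> V sV; apply: sUU; rewrite /= inE sV orbT.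
Qed.

Lemma is_string_rcons UU U s : is_string UU (rcons s U) <-> UU U /\ is_string UU s.
Proof.
rewrite -is_string_cons; split=> sUU V sV; apply: sUU; move: sV => /=;
  by rewrite mem_rcons.
Qed.

(** * Removing the first map of a sequence *)

Section Shift.
(** In the application [g0] and [g1] are consecutive tails of [f], and [a] is the first map of
    [g0]. *)
Variables (g0 g1 : nat -> X -> X) (a : X -> X).
Hypothesis shift : forall n x, iter_seq g0 n.+1 x = iter_seq g1 n (a x).

Lemma cylinder_shift U s x :
  cylinder g0 (U :: s) x <-> U x /\ cylinder g1 s (a x).
Proof.
split=> [sx|[Ux sx] [|j] js] //; last by rewrite shift; exact: sx.
split; first exact: (sx 0%N).
by move=> j js; rewrite -shift; exact: (sx j.+1).
Qed.

Lemma birkhoff_sum_shift phi n x :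
  birkhoff_sum g0 phi n.+1 x = phi x + birkhoff_sum g1 phi n (a x).
Proof.
rewrite /birkhoff_sum big_nat_recl//; congr (_ + _).
by apply: eq_bigr => j _; rewrite shift.
Qed.

Variables (phi : X -> R) (B : R).
Hypothesis phiB : forall x, `|phi x| <= B.
Variables (UU : set (set X)) (gamma : R).
Hypotheses (UUcov : finite_open_cover UU) (osc : oscillation_le phi UU gamma).
Hypothesis gamma0 : 0 <= gamma.

Let phi_le x y : phi x <= phi y + 2 * B.
Proof. by have := phiB x; have := phiB y; rewrite !ler_norml; lra. Qed.

Let UUpick x : exists2 U, UU U & U x.
Proof. by case: UUcov => _ _ UUT; have : [set: X] x by []; rewrite -UUT. Qed.

(** The [g0]-orbit of [w] is [w] followed by the [g1]-orbit of [a w], again a point of [Z]. The set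
    put in front must contain [w], hence depends on [w], so every member of [UU] is tried. *)
Lemma outer_sum_forward Z theta : a @` Z `<=` Z ->
  exists2 C : R, 0 < C & forall N alpha, (0 < N)%N ->
    (outer_sum g0 Z (alpha + gamma) phi UU N theta
       <= C%:E * outer_sum g1 Z alpha phi UU N theta)%E.
Proof.
move=> aZ; have [UUfin _ _] := UUcov.
apply: (@outer_sum_transfer _ UU (fun U s => U :: take (size s).-1 s)
  _ _ _ _ _ _ _ _ (2 * B)) => //.
  move=> U s x UUU; case/lastP: s => // s V _.
  rewrite size_rcons /= -cats1 take_size_cat// cats1.
  move=> /is_string_rcons[VUU sUU] /cylinder_rcons[sx Vx].
  split; [exact/is_string_cons|by []|move=> y /cylinder_shift[Uy sy]].
  (* Both sums run along the common part [s]; exchanging the last term for a first one costs at most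
     [2 * B]. *)
  rewrite birkhoff_sum_shift birkhoff_sumSr.
  have := birkhoff_sum_osc osc sUU sx sy; have := phi_le y (iter_seq g1 (size s) x).
  by rewrite -(natr1 (size s)) mulrDr mulr1; have := gamma0; lra.
move=> w Zw; exists (a w); first by apply: aZ; exists w.
move=> s; case/lastP: s => // s V _ _ /cylinder_rcons[sw _].
have [U UUU Uw] := UUpick w; exists U => //.
by rewrite size_rcons /= -cats1 take_size_cat//; exact/cylinder_shift.
Qed.

(** Every point of [Z] is [a z] with [z] in [Z], and the tail of a string for [z] is one for [a z].
    The appended set contains the next point of the [g1]-orbit and restores the length. *)
Lemma outer_sum_backward Z theta : Z `<=` a @` Z ->
  exists2 C : R, 0 < C & forall N alpha, (0 < N)%N ->
    (outer_sum g1 Z (alpha + gamma) phi UU N theta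
       <= C%:E * outer_sum g0 Z alpha phi UU N theta)%E.
Proof.
move=> aZ; have [UUfin _ _] := UUcov.
apply: (@outer_sum_transfer _ UU (fun U s => rcons (behead s) U)
  _ _ _ _ _ _ _ _ (2 * B)) => //.
  move=> U [//|V s] x UUU _ /is_string_cons[VUU sUU] /cylinder_shift[Vx sx] /=.
  split; [exact/is_string_rcons|by rewrite size_rcons|].
  move=> y /cylinder_rcons[sy Uy]; rewrite birkhoff_sum_shift birkhoff_sumSr.
  have := birkhoff_sum_osc osc sUU sx sy; have := phi_le (iter_seq g1 (size s) y) x.
  by rewrite -(natr1 (size s)) mulrDr mulr1; have := gamma0; lra.
move=> _ /aZ[z Zz <-]; exists z => // -[//|V s] _ _ /cylinder_shift[_ sz] /=.
have [U UUU Uw] := UUpick (iter_seq g1 (size s) (a z)); exists U => //.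
exact/cylinder_rcons.
Qed.

End Shift.

(** Replacing each [V] by a [U] around it keeps the length and enlarges the cylinder; the
    oscillation on [UU] controls the larger supremum. An empty [V] occurs in no string with nonempty
    cylinder. *)
Lemma outer_sum_refine f Z phi UU VV gamma theta :
  oscillation_le phi UU gamma ->
  (forall V, VV V -> V !=set0 -> exists2 U, UU U & V `<=` U) ->
  exists2 C : R, 0 < C & forall N alpha, (0 < N)%N ->
    (outer_sum f Z (alpha + gamma) phi UU N theta
       <= C%:E * outer_sum f Z alpha phi VV N theta)%E.
Proof.
move=> osc VU.
have /choice[r rP] : forall V, exists U, VV V -> V !=set0 -> UU U /\ V `<=` U.
  move=> V; have [[VVV V0]|nV] := pselect (VV V /\ V !=set0).
    by have [U UUU VsubU] := VU V VVV V0; exists U.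
  (* A placeholder where nothing is required of [r]. *)
  by exists set0 => VVV V0; case: nV.
have rcyl s x : is_string VV s -> cylinder f s x ->
    is_string UU (map r s) /\ cylinder f (map r s) x.
  move=> sVV sx.
  have rs_nth j : (j < size s)%N -> UU (nth set0 (map r s) j) /\
      nth set0 s j `<=` nth set0 (map r s) j.
    move=> js; rewrite (nth_map set0)//; apply: rP.
      by apply: sVV; rewrite /= mem_nth.
    by exists (iter_seq f j x); exact: sx.
  split; last by move=> j; rewrite size_map => js; apply: (rs_nth j js).2; exact: sx.
  move=> U /= /(nthP set0)[j]; rewrite size_map => js <-; exact: (rs_nth j js).1.
apply: (@outer_sum_transfer _ [set tt] (fun _ s => map r s) _ _ _ _ _ _ _ _ 0) => //.
  move=> k s x _ _ sVV sx; have [rs rx] := rcyl s x sVV sx.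
  split; [by []|by rewrite size_map|move=> y ry].
  by rewrite addr0 -(size_map r); exact: birkhoff_sum_osc osc _ _ _.
move=> w Zw; exists w => // s _ sVV sw; exists tt => //.
by have [] := rcyl s w sVV sw.
Qed.

End Comparison.

(** * Passing to the limit over covers *)

Section Limits.
Context {R : realType} {X : metricType R}.
Hypothesis X_compact : compact [set: X].
Variables (phi : X -> R) (theta : R) (L : (\bar R)^nat -> \bar R).
Hypotheses (phi_cont : continuous phi) (L_null : null_preserving L).

Let phi_bounded : exists B, forall x, `|phi x| <= B.
Proof.
have /compact_bounded[B [_ BP]] : compact (phi @` [set: X]).
  by apply: continuous_compact => //; exact: continuous_subspaceT.
by exists (B + 1) => x; apply: BP; [rewrite ltrDl|exists x].
Qed.

Let osc_near e : 0 < e ->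
  \forall UU \near @mesh_to0 R X, finite_open_cover UU /\ oscillation_le phi UU e.
Proof.
move=> e0; have [d d0 dP] := small_oscillation X_compact phi_cont e0.
exists d => // UU [UUcov UUd]; split => // U UUU; apply: dP.
by apply: le_lt_trans UUd; apply: ereal_sup_ubound; exists U.
Qed.

#[local] Instance FF : ProperFilter (@mesh_to0 R X) := mesh_to0_filter X_compact.

(** Once [UU] has oscillation at most [e], any [VV] with mesh below a Lebesgue number of [UU]
    refines it, so the value at [UU] exceeds that at [VV] by at most [e]. *)
Lemma is_cvg_pressure_cover f Z :
  cvg (pressure_cover L f Z phi theta UU @[UU --> mesh_to0]).
Proof.
apply: is_cvge_almost_le => e e0; apply: filterS (osc_near e0) => UU [[_ UUo UUT] osc].
have [d d0 dP] := lebesgue_number X_compact UUo UUT.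
exists d => // VV [VVcov VVd].
have [|C C0 CP] := @outer_sum_refine _ _ f Z phi UU VV e theta osc.
  move=> V VVV V0; apply: dP => //; apply: le_lt_trans VVd.
  by apply: ereal_sup_ubound; exists V.
exact: pressure_cover_le C0 CP.
Qed.

Variables (g0 g1 : nat -> X -> X) (a : X -> X).
Hypothesis shift : forall n x, iter_seq g0 n.+1 x = iter_seq g1 n (a x).

Lemma pressure_forward Z : a @` Z `<=` Z ->
  (pressure L g0 Z phi theta <= pressure L g1 Z phi theta)%E.
Proof.
move=> aZ; have [B phiB] := phi_bounded.
apply: lime_almost_le; [exact: is_cvg_pressure_cover..|move=> e e0].
apply: filterS (osc_near e0) => UU [UUcov osc].
have [C C0 CP] := outer_sum_forward shift phiB UUcov osc (ltW e0) theta aZ.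
exact: pressure_cover_le C0 CP.
Qed.

Lemma pressure_backward Z : Z `<=` a @` Z ->
  (pressure L g1 Z phi theta <= pressure L g0 Z phi theta)%E.
Proof.
move=> aZ; have [B phiB] := phi_bounded.
apply: lime_almost_le; [exact: is_cvg_pressure_cover..|move=> e e0].
apply: filterS (osc_near e0) => UU [UUcov osc].
have [C C0 CP] := outer_sum_backward shift phiB UUcov osc (ltW e0) theta aZ.
exact: pressure_cover_le C0 CP.
Qed.

End Limits.

(** * From one shift to arbitrary tails *)

Lemma iter_tail_seqS (X : Type) (f : nat -> X -> X) i n x :
  iter_seq (tail_seq f i) n.+1 x = iter_seq (tail_seq f i.+1) n (f i x).
Proof.
elim: n => [|n IHn]; first by rewrite /= /tail_seq addnK.
rewrite -[LHS]/(tail_seq f i n.+2 (iter_seq (tail_seq f i) n.+1 x)) IHn.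
(* On both sides the last map applied is [f (i + n.+1)]. *)
by rewrite /= /tail_seq addSnnS.
Qed.

Section Tails.
Context {R : realType} {X : metricType R}.
Hypothesis X_compact : compact [set: X].
Variables (phi : X -> R) (theta : R) (L : (\bar R)^nat -> \bar R).
Hypotheses (phi_cont : continuous phi) (L_null : null_preserving L).
Variables (f : nat -> X -> X) (Z : set X) (i j : nat).
Hypotheses (i_ge1 : (1 <= i)%N) (le_ij : (i <= j)%N).

Lemma pressure_tail_forward : forward_invariant f Z ->
  (pressure L (tail_seq f i) Z phi theta <= pressure L (tail_seq f j) Z phi theta)%E.
Proof.
move=> fZ; rewrite -(subnKC le_ij); elim: (j - i)%N => [|n]; first by rewrite addn0.
move=> /le_trans; apply; rewrite addnS.
(* One shift, from [i + n] to [i + n.+1], whose removed map is [f (i + n)]. *)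
apply: (pressure_forward X_compact theta phi_cont L_null (iter_tail_seqS f (i + n))).
by apply: fZ; rewrite ltn_addr.
Qed.

Lemma pressure_tail_backward : backward_invariant f Z ->
  (pressure L (tail_seq f j) Z phi theta <= pressure L (tail_seq f i) Z phi theta)%E.
Proof.
move=> fZ; rewrite -(subnKC le_ij); elim: (j - i)%N => [|n]; first by rewrite addn0.
apply: le_trans; rewrite addnS.
apply: (pressure_backward X_compact theta phi_cont L_null (iter_tail_seqS f (i + n))).
by apply: fZ; rewrite ltn_addr.
Qed.

End Tails.

Theorem corollary3p5 (R : realType) (X : metricType R)
    (X_compact : compact [set: X])
    (f : nat -> X -> X)
    (f_cont : forall k : nat, (1 <= k)%N -> continuous (f k))
    (Z : set X) (phi : X -> R) (phi_cont : continuous phi)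
    (i j : nat) (i_ge1 : (1 <= i)%N) (lt_ij : (i < j)%N)
    (theta : R) (theta_ge0 : 0 <= theta) (theta_le1 : theta <= 1) :
  [/\ forward_invariant f Z ->
        (lower_pressure (tail_seq f i) Z phi theta
           <= lower_pressure (tail_seq f j) Z phi theta)%E /\
        (upper_pressure (tail_seq f i) Z phi theta
           <= upper_pressure (tail_seq f j) Z phi theta)%E,
      backward_invariant f Z ->
        (lower_pressure (tail_seq f i) Z phi theta
           >= lower_pressure (tail_seq f j) Z phi theta)%E /\
        (upper_pressure (tail_seq f i) Z phi theta
           >= upper_pressure (tail_seq f j) Z phi theta)%E &
      seq_invariant f Z ->
        lower_pressure (tail_seq f i) Z phi theta
          = lower_pressure (tail_seq f j) Z phi theta /\
        upper_pressure (tail_seq f i) Z phi theta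
          = upper_pressure (tail_seq f j) Z phi theta].
Proof.
have ij := ltnW lt_ij.
have fwd L : null_preserving L -> forward_invariant f Z -> _ :=
  fun L0 => pressure_tail_forward X_compact theta phi_cont L0 i_ge1 ij.
have bwd L : null_preserving L -> backward_invariant f Z -> _ :=
  fun L0 => pressure_tail_backward X_compact theta phi_cont L0 i_ge1 ij.
have Linf := @null_preserving_limn_einf R.
have Lsup := @null_preserving_limn_esup R.
split=> [fZ|fZ|fZ].
- by split; [exact: fwd Linf fZ|exact: fwd Lsup fZ].
- by split; [exact: bwd Linf fZ|exact: bwd Lsup fZ].
have fwdZ : forward_invariant f Z by move=> k /fZ ->.
have bwdZ : backward_invariant f Z by move=> k /fZ ->.
split; apply: le_anti; apply/andP; split.
- exact: fwd Linf fwdZ.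
- exact: bwd Linf bwdZ.
- exact: fwd Lsup fwdZ.
- exact: bwd Lsup bwdZ.
Qed.
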